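(* Let $\mathbf{C}$ be the Cantor set, let $X, Y \subset \mathbf{C}$, and let $f : X \to Y$ be a continuous, clopen-$LC$ function onto $Y$ such that the inverse image $f^{-1}(y)$ of every point $y \in Y$ is compact. Let $1 \le \alpha < \omega_1$. If $X$ is a Borel set of additive class $\alpha$ in $\mathbf{C}$, then $Y$ is a Borel set of additive class $\alpha$ in $\mathbf{C}$; and if $X$ is a Borel set of multiplicative class $\alpha$ in $\mathbf{C}$, then $Y$ is a Borel set of multiplicative class $\alpha$ in $\mathbf{C}$.
   Context: Subsets of $\mathbf{C}$ carry the subspace topology. A subset of a topological space is an $LC$-set (locally closed set) if it is the intersection of an open set and a closed set. A function $f: X \to Y$ is clopen-$LC$ if for every clopen subset $U$ of $X$ the image $f(U)$ is an $LC$-set in $Y$. Borel classes are indexed as follows: additive class $1$ consists of the $F_\sigma$-sets and multiplicative class $1$ of the $G_\delta$-sets; for $1<\alpha<\omega_1$, a set is of additive class $\alpha$ if it is a countable union of sets of multiplicative classes $<\alpha$, and of multiplicative class $\alpha$ if it is a countable intersection of sets of additive classes $<\alpha$. *)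

(* Defs.v *)
From mathcomp Require Import all_boot all_order all_classical.
From mathcomp Require Import topology borel_hierarchy cantor.

Set Implicit Arguments.
Unset Strict Implicit.
Unset Printing Implicit Defensive.

Local Open Scope order_scope.
Local Open Scope classical_set_scope.

Definition LC_set (T : topologicalType) (A : set T) : Prop :=
  exists O F : set T, [/\ open O, closed F & A = O `&` F].

Definition clopen_LC (X Y : topologicalType) (f : X -> Y) : Prop :=
  forall U : set X, clopen U -> LC_set (f @` U).

(* An element [a] of a well-ordered type [W] stands for the ordinal that is
   the order type of its set of predecessors [ [set b | b < a] ]; every ordinal
   arises in this way.  Hence [\bot] is 0, the relation [<] of [W] is the order
   of ordinals, and [a] is below omega_1 iff it has countably many
   predecessors. *)
Definition ord_is1 (d : Order.disp_t) (W : bOrderType d) (a : W) : Prop :=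
  forall b : W, b < a <-> b = \bot.

Definition ord_gt1 (d : Order.disp_t) (W : bOrderType d) (a : W) : Prop :=
  exists2 o : W, ord_is1 o & o < a.

(* No set is of class 0, so the classes [b n < a] below are all at least 1. *)
Inductive borel_additive (T : topologicalType) (d : Order.disp_t)
    (W : bOrderType d) : W -> set T -> Prop :=
| Borel_additive1 (a : W) (S : set T) :
    ord_is1 a -> Fsigma S -> borel_additive a S
| Borel_additive_gt1 (a : W) (S : set T) (b : nat -> W) (F : nat -> set T) :
    ord_gt1 a -> (forall n, b n < a) ->
    (forall n, borel_multiplicative (b n) (F n)) ->
    S = \bigcup_n F n -> borel_additive a S
with borel_multiplicative (T : topologicalType) (d : Order.disp_t)
    (W : bOrderType d) : W -> set T -> Prop :=
| Borel_multiplicative1 (a : W) (S : set T) :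
    ord_is1 a -> Gdelta S -> borel_multiplicative a S
| Borel_multiplicative_gt1 (a : W) (S : set T) (b : nat -> W)
    (F : nat -> set T) :
    ord_gt1 a -> (forall n, b n < a) ->
    (forall n, borel_additive (b n) (F n)) ->
    S = \bigcap_n F n -> borel_multiplicative a S.

(* Main.v *)
Require Import Defs.
From mathcomp Require Import all_boot all_order all_classical wochoice.
From mathcomp Require Import topology borel_hierarchy cantor.

(* Write A_s for the image of the trace on X of the cylinder C_s; by hypothesis
   A_s is the trace on Y of O_s `&` F_s with O_s open and F_s closed.  Put
   E_s = closure A_s `\` O_s.  Over Y `\` \bigcup_s E_s the map is perfect: the
   closure of its graph adds nothing to the fibers there.  Over Y `&` E_s it is
   open, because C_s `|` C_t also has a locally closed image for every t.

   Given countably many closed sets H_k, choose a point in each (compact) fiber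
   greedily, deciding at step k whether it lies in H_k.  Over a perfect piece
   "the remaining part of the fiber meets H_k" is a closed condition; over an
   open piece "some cylinder inside the current one misses H_k and meets the
   fiber" is an open one.  Either way the selector pulls every H_k back to an
   Fsigma, hence, for H_k well chosen, it pulls X back to a set of the class of
   X, and each piece of Y is such a pullback.  For classes > 1 these countably
   many pieces assemble to Y; F_sigma sets are sigma-compact.

   For Gdelta sets the union of the pieces needs another argument.  If Y is not
   Gdelta, it has a nonempty closed subset Z which is nowhere locally Gdelta and
   is covered by the E_s, so that each Z `&` E_s is nowhere dense in Z.  If a
   relatively clopen part V of the preimage of Z is covered by cylinders with
   nowhere dense images, then V has a nowhere dense image itself: otherwise
   compactness of the fibers allows splitting off a relatively clopen subset of
   V whose image is both dense and codense in an open part of Z, so not locally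
   closed.  With Baire's theorem in X this makes Z nowhere dense in itself. *)

Set Implicit Arguments.
Unset Strict Implicit.
Unset Printing Implicit Defensive.

Local Open Scope classical_set_scope.

Local Notation C := cantor_space (only parsing).

(** * Cylinders of the Cantor space *)

Definition pre (n : nat) (x : C) : seq bool := mkseq x n.

Definition cyl (t : seq bool) : set C := [set x | pre (size t) x = t].

Lemma size_pre n x : size (pre n x) = n.
Proof. exact: size_mkseq. Qed.

Lemma pre_eqP n (x y : C) :
  pre n x = pre n y <-> forall i, i < n -> x i = y i.
Proof.
split=> [e i lt_in|e].
  rewrite -(nth_mkseq false x lt_in) -(nth_mkseq false y lt_in).
  by rewrite -/(pre n x) e.
apply: (@eq_from_nth _ false); rewrite !size_pre // => i lt_in.
by rewrite !nth_mkseq ?e.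
Qed.

Lemma pre_le m n (x y : C) : m <= n -> pre n x = pre n y -> pre m x = pre m y.
Proof. by move=> mn /pre_eqP e; apply/pre_eqP => i /leq_trans/(_ mn)/e. Qed.

Lemma preS n (x : C) : pre n.+1 x = rcons (pre n x) (x n).
Proof. by rewrite /pre mkseqS. Qed.

Lemma cyl_pre n (x : C) : cyl (pre n x) x.
Proof. by rewrite /cyl /= size_pre. Qed.

Lemma cyl_preE n (x y : C) : cyl (pre n x) y <-> pre n x = pre n y.
Proof. by rewrite /cyl /= size_pre; split=> ->. Qed.

Lemma cyl_rcons t b : cyl (rcons t b) `<=` cyl t.
Proof.
move=> x; rewrite /cyl /= size_rcons preS => e.
by have /rcons_inj[] := e.
Qed.

Lemma cyl_split t : cyl t = cyl (rcons t true) `|` cyl (rcons t false).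
Proof.
apply/seteqP; split=> [x|x [] /cyl_rcons //].
rewrite /cyl /= !size_rcons !preS => ->.
by case: (x (size t)); [left|right].
Qed.

Lemma nbhs_cyl (x : C) (U : set C) :
  nbhs x U <-> exists n, forall y, pre n x = pre n y -> U y.
Proof.
split=> [|[n nU]].
  (* The topology is the supremum of the topologies induced by the coordinates, so convergence of
     the filter of cylinders around [x] is checked one coordinate at a time. *)
  pose F := filter_from [set: nat] (fun n => [set y | pre n x = pre n y]).
  have FF : Filter F.
    apply: filter_from_filter; first by exists 0.
    move=> i j _ _; exists (maxn i j) => // y /= e.
    by split; apply: pre_le e; rewrite ?leq_maxl ?leq_maxr.
  suff /(_ U) Fx : F --> x by move=> /Fx[n _ nU]; exists n.
  apply/cvg_sup => i V [_ /= [[W _ <-] Wx WV]].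
  rewrite nbhs_simpl; exists i.+1 => // y /= /pre_eqP/(_ i (ltnSn i)) e.
  by apply: WV => /=; rewrite -e.
have FF : Filter (nbhs x) := @nbhs_filter cantor_space x.
have {}nU : [set y | pre n x = pre n y] `<=` U by [].
apply: (filterS nU); elim: n {nU} => [|n IHn].
  by apply: (@filterS _ (nbhs x) FF setT) => //; exact: filterT.
have xn : nbhs x [set y : C | y n = x n].
  have := @proj_continuous _ (fun _ : nat => bool) n x [set x n].
  by apply; exact: discrete_set1.
by apply: filterS (filterI IHn xn) => y [e /= en]; rewrite /= !preS e en.
Qed.

Lemma open_preP (U : set C) :
  open U <-> forall x, U x -> exists n, forall y, pre n x = pre n y -> U y.
Proof. by rewrite openE; split=> h x /h /nbhs_cyl. Qed.

Lemma closure_preP (A : set C) x :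
  closure A x <-> forall n, exists2 y, A y & pre n x = pre n y.
Proof.
split=> [clAx n|clAx U /nbhs_cyl[n nU]].
  have [|y [Ay /= e]] := clAx [set y | pre n x = pre n y]; last by exists y.
  by apply/nbhs_cyl; exists n.
by have [y Ay /nU] := clAx n; exists y.
Qed.

Lemma closed_preP (A : set C) :
  closed A <->
  forall x, (forall n, exists2 y, A y & pre n x = pre n y) -> A x.
Proof.
split=> [h x /closure_preP Ax|h x /closure_preP Ax]; [exact: h|exact: h].
Qed.

Lemma open_cyl t : open (cyl t).
Proof.
by apply/open_preP => x tx; exists (size t) => y; rewrite /cyl /= => <-.
Qed.

Lemma closed_cyl t : closed (cyl t).
Proof.
by apply/closed_preP => x /(_ (size t))[y]; rewrite /cyl /= => + ->.
Qed.

(** By compactness the filter generated by the [Q n] has a cluster point. *)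
Lemma decreasing_cluster (Q : nat -> set C) :
  (forall n, Q n.+1 `<=` Q n) -> (forall n, Q n !=set0) ->
  exists x, forall n, closure (Q n) x.
Proof.
move=> Qdec Q0.
have Qle m n : m <= n -> Q n `<=` Q m.
  by move=> /subnK <-; elim: (n - m) => // k IHk x /Qdec /IHk.
pose F := filter_from [set: nat] Q.
have FF : ProperFilter F.
  apply: filter_from_proper => //; apply: filter_from_filter; first by exists 0.
  move=> i j _ _; exists (maxn i j) => // x Qx.
  by split; apply: Qle Qx; rewrite ?leq_maxl ?leq_maxr.
have [|x [_ Fx]] := cantor_space_compact FF; first by exists 0.
exists x => n U Ux; apply: Fx => //; by exists n.
Qed.

Lemma decreasing_closed (Q : nat -> set C) :
  (forall n, closed (Q n)) -> (forall n, Q n.+1 `<=` Q n) ->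
  (forall n, Q n !=set0) -> exists x, forall n, Q n x.
Proof.
move=> Qcl Qdec Q0; have [x Qx] := decreasing_cluster Qdec Q0.
by exists x => n; exact: Qcl.
Qed.

Lemma cyl_chain (s : nat -> seq bool) :
  (forall n, cyl (s n.+1) `<=` cyl (s n)) -> exists x, forall n, cyl (s n) x.
Proof.
move=> sdec; apply: decreasing_closed => // n; first exact: closed_cyl.
(* The word [s n], continued by [false], lies in its own cylinder. *)
exists (nth false (s n)); rewrite /cyl /= /pre; exact: mkseq_nth.
Qed.

(** * Borel classes *)

(** Numbers that code no index repeat the member at [i0], so the union and all common properties of
    the family are preserved. *)
Definition enum_with (I : countType) (T : Type) (i0 : I) (F : I -> T) (n : nat)
    : T :=
  if unpickle n is Some i then F i else F i0.

Lemma enum_with_pickle (I : countType) (T : Type) (i0 : I) (F : I -> T) i :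
  enum_with i0 F (pickle i) = F i.
Proof. by rewrite /enum_with pickleK. Qed.

Lemma enum_withP (I : countType) (T : Type) (i0 : I) (F : I -> T) n :
  exists i, enum_with i0 F n = F i.
Proof. by rewrite /enum_with; case: unpickle => [i|]; [exists i|exists i0]. Qed.

Lemma bigcup_enum_with (I : countType) (T : Type) (i0 : I) (F : I -> set T) :
  \bigcup_n enum_with i0 F n = \bigcup_i F i.
Proof.
apply/seteqP; split=> x [n _ Fx].
  by have [i e] := enum_withP i0 F n; exists i => //; rewrite -e.
by exists (pickle n); rewrite ?enum_with_pickle.
Qed.

Lemma setIC_trace (T : Type) (D A B : set T) :
  D `&` A = D `&` B -> D `&` ~` A = D `&` ~` B.
Proof.
move=> e; apply/seteqP; split=> x [Dx nx]; split=> // hx; apply: nx.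
  by have : (D `&` B) x by []; rewrite -e => -[].
by have : (D `&` A) x by []; rewrite e => -[].
Qed.

Section FsigmaGdelta.
Variable T : topologicalType.
Implicit Types A B : set T.

Lemma FsigmaC A : Fsigma (~` A) <-> Gdelta A.
Proof.
split=> -[F hF e]; exists (fun n => ~` F n).
- by move=> i; apply: closed_openC.
- by rewrite -setC_bigcup -e setCK.
- by move=> i; apply: open_closedC.
- by rewrite e setC_bigcap.
Qed.

Lemma GdeltaC A : Gdelta (~` A) <-> Fsigma A.
Proof. by rewrite -FsigmaC setCK. Qed.

Lemma Fsigma_bigcup (I : countType) (i0 : I) (F : I -> set T) :
  (forall i, Fsigma (F i)) -> Fsigma (\bigcup_i F i).
Proof.
move=> /(_ _)/cid2 hF; pose G i := projT1 (hF i).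
exists (enum_with (i0, 0) (fun p : I * nat => G p.1 p.2)).
  move=> n; rewrite /enum_with; case: unpickle => [p|]; rewrite /G;
  by case: (hF _).
rewrite bigcup_enum_with; apply/seteqP; split=> x.
  move=> [i _]; have [_ /seteqP[+ _]] := projT2 (hF i) => /[apply] -[n _ ?].
  by exists (i, n).
move=> [[i n] _ /= Gx]; exists i => //.
by case: (projT2 (hF i)) => _ ->; exists n.
Qed.

Lemma Gdelta_bigcap (I : countType) (i0 : I) (F : I -> set T) :
  (forall i, Gdelta (F i)) -> Gdelta (\bigcap_i F i).
Proof.
move=> hF; apply/FsigmaC; rewrite setC_bigcap.
by apply: Fsigma_bigcup => // i; apply/FsigmaC.
Qed.

Lemma FsigmaU A B : Fsigma A -> Fsigma B -> Fsigma (A `|` B).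
Proof.
move=> hA hB; rewrite -bigcup2E; apply: (Fsigma_bigcup 0) => -[|[|n]] //.
by apply: closed_Fsigma; exact: closed0.
Qed.

Lemma GdeltaI A B : Gdelta A -> Gdelta B -> Gdelta (A `&` B).
Proof.
move=> /FsigmaC hA /FsigmaC hB; apply/FsigmaC.
by rewrite setCI; exact: FsigmaU.
Qed.

Lemma FsigmaI A B : Fsigma A -> Fsigma B -> Fsigma (A `&` B).
Proof.
move=> [F hF ->] [G hG ->].
have -> : \bigcup_n F n `&` \bigcup_n G n =
          \bigcup_(p : nat * nat) (F p.1 `&` G p.2).
  apply/seteqP; split=> x; first by move=> [[i _ ?] [j _ ?]]; exists (i, j).
  by move=> [[i j] _ [? ?]]; split; [exists i|exists j].
by apply: (Fsigma_bigcup (0, 0)) => p; apply: closed_Fsigma; exact: closedI.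
Qed.

Lemma GdeltaU A B : Gdelta A -> Gdelta B -> Gdelta (A `|` B).
Proof.
move=> /FsigmaC hA /FsigmaC hB; apply/FsigmaC.
by rewrite setCU; exact: FsigmaI.
Qed.

End FsigmaGdelta.

(** The cylinders inside [U] cover it; they are closed and countably many. *)
Lemma open_Fsigma (U : set C) : open U -> Fsigma U.
Proof.
move=> /open_preP oU.
have -> : U = \bigcup_(t : seq bool) [set x | cyl t `<=` U /\ cyl t x].
  apply/seteqP; split=> x; last by move=> [t _ [+ tx]]; apply.
  move=> /oU[n nU]; exists (pre n x) => //; split; last exact: cyl_pre.
  by move=> y /cyl_preE; exact: nU.
apply: (Fsigma_bigcup [::]) => t; apply: closed_Fsigma.
have [tU|tU] := pselect (cyl t `<=` U).
  by have -> : [set x | cyl t `<=` U /\ cyl t x] = cyl t;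
    [apply/seteqP; split=> x // []|exact: closed_cyl].
by have -> : [set x | cyl t `<=` U /\ cyl t x] = set0;
  [apply/seteqP; split=> x // []|exact: closed0].
Qed.

Lemma closed_Gdelta (A : set C) : closed A -> Gdelta A.
Proof. by move=> clA; apply/FsigmaC/open_Fsigma/closed_openC. Qed.

Scheme borel_additive_mut := Minimality for borel_additive Sort Prop
with borel_multiplicative_mut := Minimality for borel_multiplicative Sort Prop.
Combined Scheme borel_mut from borel_additive_mut, borel_multiplicative_mut.

Section BorelClasses.
Variables (d : Order.disp_t) (W : bOrderType d).
Implicit Types (a b : W) (S D : set C).

Lemma ord_is1_gt1 a : ord_is1 a -> ord_gt1 a -> False.
Proof.
move=> a1 [o o1 /a1 e]; have := (o1 \bot%O).2 erefl.
by rewrite e Order.POrderTheory.ltxx.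
Qed.

Definition ord_ge1 a := ord_is1 a \/ ord_gt1 a.

Lemma additiveP a S : borel_additive a S <->
  (ord_is1 a /\ Fsigma S) \/
  (ord_gt1 a /\ exists (b : nat -> W) (F : nat -> set C),
    [/\ forall n : nat, (b n < a)%O,
    forall n, borel_multiplicative (b n) (F n) & S = \bigcup_n F n]).
Proof.
split=> [[{}a {}S a1 hS|{}a {}S b F a1 hb hF e]|]; first by left.
  by right; split=> //; exists b, F.
by move=> [[]|[a1 [b [F [hb hF e]]]]];
  [exact: Borel_additive1|exact: Borel_additive_gt1 hF e].
Qed.

Lemma additive_multiplicative_setC a :
  (forall S, borel_additive a S -> borel_multiplicative a (~` S)) /\
  (forall S, borel_multiplicative a S -> borel_additive a (~` S)).
Proof.
suff [h1 h2] :
    (forall a S, borel_additive a S -> borel_multiplicative a (~` S)) /\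
    (forall a S, borel_multiplicative a S -> borel_additive a (~` S)).
  by split=> S; [exact: h1|exact: h2].
apply: borel_mut => {}a S.
- by move=> a1 hS; apply: Borel_multiplicative1 => //; apply/GdeltaC.
- move=> b F a1 hb _ hF ->; rewrite setC_bigcup.
  exact: (Borel_multiplicative_gt1 a1 hb hF).
- by move=> a1 hS; apply: Borel_additive1 => //; apply/FsigmaC.
- move=> b F a1 hb _ hF ->; rewrite setC_bigcap.
  exact: (Borel_additive_gt1 a1 hb hF).
Qed.

Lemma additiveC a S : borel_additive a (~` S) <-> borel_multiplicative a S.
Proof.
have [h1 h2] := additive_multiplicative_setC a.
by split=> [/h1|/h2//]; rewrite setCK.
Qed.

Lemma multiplicativeC a S :
  borel_multiplicative a (~` S) <-> borel_additive a S.
Proof. by rewrite -additiveC setCK. Qed.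

Lemma additive_ge1 a S : borel_additive a S -> ord_ge1 a.
Proof. by move=> /additiveP[[]|[]]; [left|right]. Qed.

Lemma multiplicative_ge1 a S : borel_multiplicative a S -> ord_ge1 a.
Proof. by move=> /additiveC/additive_ge1. Qed.

(** Above class 1, the closed sets with union [S] are Gdelta, hence of multiplicative class 1, and
    that index lies below [a]. *)
Lemma Fsigma_additive a S : ord_ge1 a -> Fsigma S -> borel_additive a S.
Proof.
move=> [a1|a1] hS; first exact: Borel_additive1.
have [o o1 oa] := a1; have [F hF e] := hS.
apply: (Borel_additive_gt1 a1 (fun=> oa) _ e) => n.
exact/Borel_multiplicative1/closed_Gdelta.
Qed.

Lemma Gdelta_multiplicative a S :
  ord_ge1 a -> Gdelta S -> borel_multiplicative a S.
Proof.
by move=> a1 hS; apply/additiveC/Fsigma_additive => //; apply/FsigmaC.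
Qed.

Lemma additive_bigcup (I : countType) (i0 : I) a (F : I -> set C) :
  (forall i, borel_additive a (F i)) -> borel_additive a (\bigcup_i F i).
Proof.
move=> hF; have [a1|a1] := additive_ge1 (hF i0).
  apply: Borel_additive1 => //; apply: Fsigma_bigcup => // i.
  by have /additiveP[[]|[a2]] := hF i => //; case: (ord_is1_gt1 a1 a2).
have /(_ _)/cid hG i : exists G : nat -> W * set C,
    [/\ forall n, ((G n).1 < a)%O,
        forall n, borel_multiplicative (G n).1 (G n).2 &
        F i = \bigcup_n (G n).2].
  have /additiveP[[a2]|[_ [b [G [? ? ?]]]]] := hF i.
    by case: (ord_is1_gt1 a2 a1).
  by exists (fun n => (b n, G n)).
pose G := enum_with (i0, 0) (fun p : I * nat => projT1 (hG p.1) p.2).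
have GP n : exists p : I * nat, G n = projT1 (hG p.1) p.2.
  exact: (enum_withP (i0, 0) (fun p : I * nat => projT1 (hG p.1) p.2) n).
apply: (@Borel_additive_gt1 _ _ _ _ _ (fst \o G) (snd \o G) a1) => [n|n|].
- by have [p /= ->] := GP n; have [h _ _] := projT2 (hG p.1); exact: h.
- by have [p /= ->] := GP n; have [_ h _] := projT2 (hG p.1); exact: h.
apply/seteqP; split=> x [i _].
  have [_ _ ->] := projT2 (hG i) => -[n _ Gx].
  by exists (pickle (i, n)) => //=; rewrite /G enum_with_pickle.
have [p /= ->] := GP i => Gx; exists p.1 => //.
by have [_ _ ->] := projT2 (hG p.1); exists p.2.
Qed.

Lemma additiveU a S D :
  borel_additive a S -> borel_additive a D -> borel_additive a (S `|` D).
Proof.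
move=> hS hD.
have -> : S `|` D = \bigcup_(b : bool) (if b then S else D).
  apply/seteqP; split=> x; first by move=> [?|?]; [exists true|exists false].
  by move=> [[] _ ?]; [left|right].
by apply: (additive_bigcup true) => -[].
Qed.

Lemma multiplicativeI a S D :
  borel_multiplicative a S -> borel_multiplicative a D ->
  borel_multiplicative a (S `&` D).
Proof.
move=> /additiveC hS /additiveC hD; apply/additiveC.
by rewrite setCI; exact: additiveU.
Qed.

(** Being of every multiplicative class, [D] can be distributed over the union and absorbed by its
    members. At class 1 the members are closed and cannot absorb it. *)
Lemma additiveI_Gdelta a S D : ord_gt1 a ->
  borel_additive a S -> Gdelta D -> borel_additive a (D `&` S).
Proof.
move=> a1 /additiveP[[a2]|[_ [b [F [hb hF ->]]]]] hD.
  by case: (ord_is1_gt1 a2 a1).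
rewrite setI_bigcupr; apply: (Borel_additive_gt1 a1 hb) => [n|//].
apply: multiplicativeI => //; apply: Gdelta_multiplicative => //.
exact: multiplicative_ge1 (hF n).
Qed.

(* Sets of class [a] pull back to sets of class [a] under every map that pulls
   countably many closed sets, depending on the set only, back to Fsigma's. *)
Lemma class_trace a :
  (forall S, borel_additive a S -> exists2 H : nat -> set C,
    forall k, closed (H k) & forall (D : set C) (s : C -> C),
    (forall k, exists2 P, Fsigma P & D `&` s @^-1` H k = D `&` P) ->
    exists2 T, borel_additive a T & D `&` s @^-1` S = D `&` T) /\
  (forall S, borel_multiplicative a S -> exists2 H : nat -> set C,
    forall k, closed (H k) & forall (D : set C) (s : C -> C),
    (forall k, exists2 P, Fsigma P & D `&` s @^-1` H k = D `&` P) ->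
    exists2 T, borel_multiplicative a T & D `&` s @^-1` S = D `&` T).
Proof.
pose Add a S := exists2 H : nat -> set C,
  forall k, closed (H k) & forall (D : set C) (s : C -> C),
  (forall k, exists2 P, Fsigma P & D `&` s @^-1` H k = D `&` P) ->
  exists2 T, borel_additive a T & D `&` s @^-1` S = D `&` T.
pose Mult a S := exists2 H : nat -> set C,
  forall k, closed (H k) & forall (D : set C) (s : C -> C),
  (forall k, exists2 P, Fsigma P & D `&` s @^-1` H k = D `&` P) ->
  exists2 T, borel_multiplicative a T & D `&` s @^-1` S = D `&` T.
(* Traces on [D] commute with complements, so the same [H] serves [S] and its complement. *)
have AddC b S : Add b S -> Mult b (~` S).
  move=> [H Hcl hH]; exists H => // D s /hH[T hT e]; exists (~` T).
    exact/multiplicativeC.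
  by rewrite preimage_setC; exact: setIC_trace.
have MultC b S : Mult b S -> Add b (~` S).
  move=> [H Hcl hH]; exists H => // D s /hH[T hT e]; exists (~` T).
    exact/additiveC.
  by rewrite preimage_setC; exact: setIC_trace.
have base b S : ord_is1 b -> Fsigma S -> Add b S.
  move=> b1 [F hF ->]; exists F => // D s /(_ _)/cid2 hP.
  exists (\bigcup_k projT1 (hP k)).
    apply: Borel_additive1 => //; apply: (Fsigma_bigcup 0) => k.
    by case: (projT2 (hP k)).
  rewrite preimage_bigcup !setI_bigcupr; apply: eq_bigcup => // k _.
  by case: (projT2 (hP k)).
(* The sequences belonging to the [F n] are merged into one by coding pairs. *)
have step b (c : nat -> W) (F : nat -> set C) :
    ord_gt1 b -> (forall n : nat, (c n < b)%O) ->
    (forall n, Mult (c n) (F n)) -> Add b (\bigcup_n F n).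
  move=> b1 hc /(_ _)/cid2 hF.
  pose H := enum_with (0, 0) (fun p : nat * nat => projT1 (hF p.1) p.2).
  exists H.
    move=> k; rewrite /H; have [p ->] :=
      enum_withP (0, 0) (fun p : nat * nat => projT1 (hF p.1) p.2) k.
    by case: (projT2 (hF p.1)).
  move=> D s hD.
  have /(_ _)/cid2 hT n : exists2 T, borel_multiplicative (c n) T &
      D `&` s @^-1` F n = D `&` T.
    case: (projT2 (hF n)) => _; apply => k.
    by have := hD (pickle (n, k)); rewrite /H enum_with_pickle.
  exists (\bigcup_n projT1 (hT n)).
    by apply: (Borel_additive_gt1 b1 hc) => // n; case: (projT2 (hT n)).
  rewrite preimage_bigcup !setI_bigcupr; apply: eq_bigcup => // k _.
  by case: (projT2 (hT k)).
suff [h1 h2] : (forall a S, borel_additive a S -> Add a S) /\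
  (forall a S, borel_multiplicative a S -> Mult a S).
  by split=> S; [exact: h1|exact: h2].
apply: borel_mut => {}a S.
- exact: base.
- by move=> b F a1 hb _ hF ->; exact: step hF.
- by move=> a1 hS; rewrite -(setCK S); apply/AddC/base => //; apply/FsigmaC.
- move=> b F a1 hb _ hF ->; rewrite -(setCK (\bigcap_n F n)).
  apply: (AddC).
  by rewrite setC_bigcap; apply: (step _ b) => // n; exact: AddC.
Qed.

End BorelClasses.

(** * Greedy selectors *)

Definition rel_Fsigma (D A : set C) :=
  exists2 P, Fsigma P & D `&` A = D `&` P.

Lemma rel_FsigmaI D A B :
  rel_Fsigma D A -> rel_Fsigma D B -> rel_Fsigma D (A `&` B).
Proof.
move=> [P hP eP] [Q hQ eQ]; exists (P `&` Q); first exact: FsigmaI.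
by rewrite setIA eP setIAC eQ -setIA [Q `&` P]setIC.
Qed.

Lemma rel_Fsigma_bigcup D (I : countType) (i0 : I) (F : I -> set C) :
  (forall i, rel_Fsigma D (F i)) -> rel_Fsigma D (\bigcup_i F i).
Proof.
move=> /(_ _)/cid2 hF; exists (\bigcup_i projT1 (hF i)).
  by apply: (Fsigma_bigcup i0) => i; case: (projT2 (hF i)).
rewrite !setI_bigcupr; apply: eq_bigcup => // i _.
by case: (projT2 (hF i)).
Qed.

Lemma Fsigma_rel D A : Fsigma A -> rel_Fsigma D A.
Proof. by exists A. Qed.

Section GreedySelector.
Variables (D : set C) (M : C -> set C) (H : nat -> set C).
Variables (P : seq nat -> set C) (next : C -> seq nat -> nat).
(* States list the past moves, last one first; the move [0] commits the selected
   point to [H (size u)], all other moves to its complement. *)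
Hypothesis M_closed : forall z, closed (M z).
Hypothesis P_closed : forall u, closed (P u).
Hypothesis start : forall z, D z -> M z `&` P [::] !=set0.
Hypothesis stepP : forall z u, D z -> M z `&` P u !=set0 ->
  let j := next z u in
  [/\ P (j :: u) `<=` P u, M z `&` P (j :: u) !=set0 &
      if j == 0 then M z `&` P (j :: u) `<=` H (size u)
      else M z `&` P (j :: u) `<=` ~` H (size u)].
Hypothesis next_Fsigma : forall u j, rel_Fsigma D [set z | next z u = j].

Fixpoint greedy_state (z : C) (k : nat) : seq nat :=
  if k is k'.+1 then
    let u := greedy_state z k' in next z u :: u
  else [::].

Lemma size_greedy_state z k : size (greedy_state z k) = k.
Proof. by elim: k => //= k ->. Qed.

Lemma greedy_state_nonempty z k : D z -> M z `&` P (greedy_state z k) !=set0.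
Proof.
move=> Dz; elim: k => [|k IHk]; first exact: start.
by have [] := stepP Dz IHk.
Qed.

Lemma greedy_state_Fsigma k u : rel_Fsigma D [set z | greedy_state z k = u].
Proof.
elim: k u => [|k IHk] u.
  have [->|u0] := eqVneq u [::].
    exists setT; first by apply: closed_Fsigma; exact: closedT.
    by apply/seteqP; split=> z [Dz _]; split.
  exists set0; first by apply: closed_Fsigma; exact: closed0.
  by apply/seteqP; split=> z [_] //= e; rewrite -e eqxx in u0.
case: u => [|j u].
  exists set0; first by apply: closed_Fsigma; exact: closed0.
  by apply/seteqP; split=> z [].
have -> : [set z | greedy_state z k.+1 = j :: u] =
    [set z | greedy_state z k = u] `&` [set z | next z u = j].
  by apply/seteqP; split=> z /= [] => [<- <-|<- <-].
exact: rel_FsigmaI.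
Qed.

(** Compactness yields a point in all the decreasing sets [M z] with [P (greedy_state z k)]. It lies
    in [H k] exactly when move [k] is [0], and this is a countable union, over the possible states,
    of relative Fsigma conditions on [z]. *)
Lemma greedy_selector : exists2 s : C -> C, forall z, D z -> M z (s z) &
  forall k, rel_Fsigma D (s @^-1` H k).
Proof.
have /choice[s hs] z : exists x, D z ->
    forall k, (M z `&` P (greedy_state z k)) x.
  have [Dz|nDz] := pselect (D z); last by exists z.
  have [k|k|k|x hx] :=
      @decreasing_closed (fun k => M z `&` P (greedy_state z k)).
  - exact: closedI.
  - by have [Psub _ _] := stepP Dz (greedy_state_nonempty k Dz); exact: setIS.
  - exact: greedy_state_nonempty.
  - by exists x.
exists s => [z Dz|k]; first by have [] := hs z Dz 0.
have e z : D z -> H k (s z) <-> next z (greedy_state z k) = 0.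
  move=> Dz; have [_ _] := stepP Dz (greedy_state_nonempty k Dz).
  rewrite size_greedy_state; have := hs z Dz k.+1; rewrite /=.
  by case: eqP => [-> h /(_ _ h)//|n0 h /(_ _ h)].
have [Q hQ eQ] : rel_Fsigma D (\bigcup_u
    ([set z | greedy_state z k = u] `&` [set z | next z u = 0])).
  apply: (rel_Fsigma_bigcup [::]) => u.
  by apply: rel_FsigmaI => //; exact: greedy_state_Fsigma.
exists Q => //; rewrite -eQ; apply/seteqP; split=> z [Dz].
  by move=> /(e z Dz) n0; split=> //; exists (greedy_state z k).
by move=> [u _ [/= <- n0]]; split=> //; apply/e.
Qed.

End GreedySelector.

(** The trace of [U] on [X] is clopen in [X]; outside [X] the set [U] is arbitrary. *)
Definition rel_clopen (X U : set C) := forall x, X x ->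
  exists n, forall x', X x' -> pre n x = pre n x' -> (U x <-> U x').

(** The hypotheses on [f], for a total map that matters only on [X]. In the Cantor space closed
    fibers are the same as compact ones. *)
Record clopen_LC_map (X Y : set C) (g : C -> C) : Prop := {
  LCmap_onto : g @` X = Y;
  LCmap_cont : forall x n, X x -> exists m, forall x', X x' ->
    pre m x = pre m x' -> pre n (g x) = pre n (g x');
  LCmap_fiber : forall y, closed (X `&` g @^-1` [set y]);
  LCmap_LC : forall U, rel_clopen X U -> exists O E,
    [/\ open O, closed E & g @` (X `&` U) = Y `&` (O `&` E)] }.

(** * The closure of the graph and the selector over the perfect piece *)

Section Pieces.
Variables (X Y : set C) (g : C -> C).
Hypothesis gLC : clopen_LC_map X Y g.

Lemma LCmap_sub x : X x -> Y (g x).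
Proof. by rewrite -(LCmap_onto gLC) => Xx; exists x. Qed.

Lemma rel_clopen_cyl t : rel_clopen X (cyl t).
Proof. by move=> x _; exists (size t) => x' _ e; rewrite /cyl /= e. Qed.

Lemma rel_clopenU U V : rel_clopen X U -> rel_clopen X V ->
  rel_clopen X (U `|` V).
Proof.
move=> hU hV x Xx; have [m hm] := hU x Xx; have [n hn] := hV x Xx.
exists (maxn m n) => x' Xx' e.
have eU := hm x' Xx' (pre_le (leq_maxl _ _) e).
have eV := hn x' Xx' (pre_le (leq_maxr _ _) e).
by split=> -[/eU|/eV]; [left|right|left|right].
Qed.

(* The fiber over [z] of the closure of the graph of [g]. *)
Definition graph_fiber (z : C) : set C := [set x | forall n,
  exists x', [/\ X x', pre n x = pre n x' & pre n z = pre n (g x')]].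

Lemma graph_fiber_closed z : closed (graph_fiber z).
Proof.
apply/closed_preP => x hx n; have [y /(_ n)[x' [Xx' e1 e2]] e] := hx n.
by exists x'; split=> //; rewrite e.
Qed.

Lemma graph_fiberE z x : X x -> graph_fiber z x -> z = g x.
Proof.
move=> Xx hx; apply/funext => i.
have [m hm] := LCmap_cont gLC i.+1 Xx.
have [x' [Xx' e1 e2]] := hx (maxn m i.+1).
have /pre_eqP/(_ i (ltnSn i)) -> := hm x' Xx' (pre_le (leq_maxl _ _) e1).
by have /pre_eqP/(_ i) -> // := pre_le (leq_maxr m _) e2.
Qed.

Lemma graph_fiber_g x : X x -> graph_fiber (g x) x.
Proof. by move=> Xx n; exists x. Qed.

(** This is the projection of a closed subset of the product along a compact factor. *)
Lemma graph_fiber_meets_closed (H : set C) :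
  closed H -> closed [set z | graph_fiber z `&` H !=set0].
Proof.
move=> Hcl; apply/closed_preP => z hz.
pose Q n := [set x | H x /\ exists x',
  [/\ X x', pre n x = pre n x' & pre n z = pre n (g x')]].
have Qdec n : Q n.+1 `<=` Q n.
  move=> x [Hx [x' [Xx' e1 e2]]]; split=> //; exists x'.
  by split=> //; [exact: pre_le e1|exact: pre_le e2].
have [n|x hx] := decreasing_cluster Qdec.
  have [z' [x [/(_ n)[x' [Xx' e1 e2]] Hx]] ez] := hz n.
  by exists x; split=> //; exists x'; rewrite ez.
exists x; split=> [n|].
  have /closure_preP/(_ n)[y [_ [x' [Xx' e1 e2]]] e] := hx n.
  by exists x'; rewrite e.
apply: Hcl; apply/closure_preP => n.
by have /closure_preP/(_ n)[y [Hy _] e] := hx n; exists y.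
Qed.

(** Over points of [X] the closed graph determines the value of [g]. This settles Fsigma sets [X],
    which are countable unions of such [H]. *)
Lemma image_closed (H : set C) : closed H -> H `<=` X -> closed (g @` H).
Proof.
move=> Hcl HX.
have -> : g @` H = [set z | graph_fiber z `&` H !=set0].
  apply/seteqP; split=> z.
    by move=> [x Hx <-]; exists x; split=> //; exact/graph_fiber_g/HX.
  by move=> [x [hx Hx]]; exists x => //; rewrite (graph_fiberE (HX _ Hx) hx).
exact: graph_fiber_meets_closed.
Qed.

Lemma graph_fiber_selector (H : nat -> set C) : (forall k, closed (H k)) ->
  exists D s, [/\ closed D, forall k, rel_Fsigma D (s @^-1` H k),
    forall z, D z <-> graph_fiber z !=set0 &
    forall z, D z -> graph_fiber z (s z)].
Proof.
move=> Hcl; pose D := [set z | graph_fiber z !=set0].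
(* [P u] intersects the sets committed to so far. Move [1] is made only if the rest of the fiber
   misses [H (size u)], so it needs no shrinking. *)
pose P := fix P u := if u is j :: u' then
  if j == 0 then P u' `&` H (size u') else P u' else [set: C].
have Pcl u : closed (P u).
  elim: u => [|j u IHu] /=; first exact: closedT.
  by case: ifP => // _; exact: closedI.
pose next z u : nat := ~~ `[< graph_fiber z `&` (P u `&` H (size u)) !=set0 >].
have Dcl : closed D.
  have := graph_fiber_meets_closed closedT.
  by congr (closed _); apply/funext => z; rewrite /= setIT.
have [|||s sP sH] := @greedy_selector D graph_fiber H P next
    graph_fiber_closed Pcl.
- by move=> z; rewrite /= setIT.
- move=> z u Dz hu; rewrite /next.
  case: asboolP => /= hj; first by split=> // x [_ []].
  by split=> // x [zx Pux] Hx; apply: hj; exists x.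
- move=> u j; pose A := [set z | graph_fiber z `&` (P u `&` H (size u)) !=set0].
  have Acl : closed A by apply: graph_fiber_meets_closed; exact: closedI.
  case: j => [|[|j]]; apply: Fsigma_rel.
  + have -> : [set z | next z u = 0] = A.
      by apply/seteqP; split=> z; rewrite /= /next; case: asboolP.
    exact: closed_Fsigma.
  + have -> : [set z | next z u = 1] = ~` A.
      by apply/seteqP; split=> z; rewrite /= /next; case: asboolP.
    by apply/open_Fsigma/closed_openC.
  + have -> : [set z | next z u = j.+2] = set0.
      by apply/seteqP; split=> z; rewrite /= /next; case: asboolP.
    by apply: closed_Fsigma; exact: closed0.
- by exists D, s.
Qed.

End Pieces.

Lemma cylE t x : cyl t x -> t = pre (size t) x.
Proof. by []. Qed.

(** * The selector over an open piece *)

Section OpenPiece.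
Variables (X Y : set C) (g : C -> C).
Hypothesis gLC : clopen_LC_map X Y g.
Variables (E : set C) (O : seq bool -> set C).
Hypothesis E_closed : closed E.
Hypothesis O_open : forall t, open (O t).
Hypothesis O_image : forall t y, Y y -> E y ->
  (O t y <-> (g @` (X `&` cyl t)) y).

(** Here the [O t] behave like images of cylinders: the root is hit, [O t] is the union of its two
    halves, and its points are limits of the image of [cyl t]. Implications are written as unions,
    which shows that the set is Gdelta. *)
Definition open_domain : set C := E `&` (O [::] `&`
  \bigcap_t ((~` O t `|` (O (rcons t true) `|` O (rcons t false))) `&`
    ((O t `|` ~` (O (rcons t true) `|` O (rcons t false))) `&`
     (~` O t `|` closure (g @` (X `&` cyl t)))))).

Lemma open_domain_Gdelta : Gdelta open_domain.
Proof.
have OU t : open (O (rcons t true) `|` O (rcons t false)) by exact: openU.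
have GO (A : set C) : open A -> Gdelta A by exact: open_Gdelta.
have GOC (A : set C) : open A -> Gdelta (~` A).
  by move=> oA; apply: closed_Gdelta; exact: open_closedC.
apply: GdeltaI; first exact: closed_Gdelta.
apply: GdeltaI; first exact: GO.
apply: (Gdelta_bigcap [::]) => t; apply: GdeltaI.
  by apply: GdeltaU; [exact: GOC|exact: GO].
apply: GdeltaI; apply: GdeltaU; [exact: GO|exact: GOC|exact: GOC|].
by apply: closed_Gdelta; exact: closed_closure.
Qed.

Lemma sub_open_domain : Y `&` E `<=` open_domain.
Proof.
move=> y [Yy Ey]; split=> //; split.
  apply/O_image => //; have := Yy; rewrite -(LCmap_onto gLC) => -[x Xx e].
  by exists x.
have split_O t : O t y <-> O (rcons t true) y \/ O (rcons t false) y.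
  rewrite !O_image //; split=> [[x [Xx]]|].
    by rewrite cyl_split => -[tx|tx] e; [left|right]; exists x.
  by move=> [] [x [Xx tx] e]; exists x => //; split=> //; exact: cyl_rcons tx.
move=> t _; split; last split.
- by have [/split_O|] := pselect (O t y); [right|left].
- have [h|h] := pselect (O t y); [by left|right=> /split_O; exact: h].
- have [h|h] := pselect (O t y); [right|by left].
  by apply: subset_closure; apply/O_image.
Qed.

Lemma open_domain_split z t : open_domain z ->
  (O t z <-> O (rcons t true) z \/ O (rcons t false) z).
Proof.
move=> [_ [_ /(_ t I)[h1 [h2 _]]]]; split=> h.
  by case: h1.
by case: h2 => // h2; case: (h2 h).
Qed.

(** The branches of the tree of words [t] with [O t z]; for [z] in [Y] and [E] they form the fiber
    of [g] over [z]. *)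
Definition branches (z : C) : set C := [set x | forall n, O (pre n x) z].

Lemma open_domain_pre z x m n : open_domain z ->
  n <= m -> O (pre m x) z -> O (pre n x) z.
Proof.
move=> Dz /subnK <-; elim: (m - n) => // k IHk; rewrite addSn preS => h.
by apply: IHk; apply/(open_domain_split _ Dz); case: (x _) h; [left|right].
Qed.

Lemma branches_closed z : closed (branches z).
Proof.
apply/closed_preP => x hx n; have [y yz e] := hx n.
by rewrite e; exact: yz.
Qed.

(** The splitting condition lets each word of the tree be prolonged forever. So hitting [cyl t] is
    an open condition on [z], relative to the domain. *)
Lemma branches_meets_cyl z t : open_domain z ->
  (branches z `&` cyl t) !=set0 <-> O t z.
Proof.
move=> Dz; split=> [[x [hx /cylE ->]]|Otz]; first exact: hx.
pose next s := rcons s `[< O (rcons s true) z >].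
pose s k := iter k next t.
have sO k : O (s k) z.
  elim: k => //= k /(open_domain_split _ Dz) h.
  by rewrite /next; case: asboolP => //; case: h.
have [k|x hx] := @cyl_chain s; first exact: cyl_rcons.
exists x; split; last exact: hx 0.
have size_s k : size (s k) = size t + k.
  by elim: k => [|k IHk]; rewrite ?addn0 //= size_rcons IHk addnS.
move=> n; apply: (@open_domain_pre z x (size t + n)) => //.
  exact: leq_addl.
by rewrite -size_s -(cylE (hx n)).
Qed.

(** By the closure condition there are points of [X] close to [x] with values close to [z];
    continuity at [x] does the rest. Hence a selected point in [X] certifies that [z] is in [Y]. *)
Lemma branches_g z x : open_domain z -> branches z x -> X x -> z = g x.
Proof.
move=> Dz zx Xx; apply/funext => i.
have [m hm] := LCmap_cont gLC i.+1 Xx.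
have [_ [_ /(_ (pre m x) I)[_ [_ []//]]]] := Dz; first by move/(_ (zx m)).
move=> /closure_preP/(_ i.+1)[_ [x' [Xx' /cyl_preE e1] <-]].
by move=> /pre_eqP/(_ i (ltnSn i)) ->; have /pre_eqP -> := hm x' Xx' e1.
Qed.

Lemma branches_fiber y x : Y y -> E y -> branches y x -> X x /\ g x = y.
Proof.
move=> Yy Ey yx.
suff [] : (X `&` g @^-1` [set y]) x by [].
apply: ((closed_preP _).1 (@LCmap_fiber _ _ _ gLC y)) => n.
have /O_image[//|//|x' [Xx' /cyl_preE e] gx'] := yx n.
by exists x'.
Qed.

Lemma open_piece_selector (H : nat -> set C) : (forall k, closed (H k)) ->
  exists D s, [/\ Gdelta D, forall k, rel_Fsigma D (s @^-1` H k) &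
    Y `&` E = D `&` s @^-1` X].
Proof.
(* The move [j.+1] passes to the cylinder coded by [j], the move [0] stays in
   the current cylinder [cyl (Q u)]. *)
move=> Hcl; pose code j : seq bool := odflt [::] (unpickle j).
have codeK t : code (pickle t) = t by rewrite /code pickleK.
pose Q := fix Q u := if u is j :: u' then
  if j is i.+1 then code i else Q u' else [::].
pose ok u j : set C := [set z | [/\ cyl (code j) `<=` cyl (Q u),
  cyl (code j) `<=` ~` H (size u) & O (code j) z]].
have ok_open u j : open (ok u j).
  have [h|h] := pselect (cyl (code j) `<=` cyl (Q u) /\
                         cyl (code j) `<=` ~` H (size u)).
    have -> : ok u j = O (code j) by apply/seteqP; split=> z; [case|case: h].
    exact: O_open.
  have -> : ok u j = set0.
    by apply/seteqP; split=> z // [h1 h2 _]; apply: h.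
  exact: open0.
(* Taking the least admissible code makes each move depend on [z] through differences of open sets;
   [0] means that no code is admissible. *)
pose spec z u j := if j is i.+1 then
    ok u i z /\ forall i', i' < i -> ~ ok u i' z
  else forall i', ~ ok u i' z.
have spec_ex z u : exists j, spec z u j.
  have [[i hi]|h] := pselect (exists i, `[< ok u i z >]); last first.
    by exists 0 => i hi; apply: h; exists i; apply/asboolP.
  have hex : exists i, `[< ok u i z >] by exists i.
  exists (ex_minn hex).+1; case: ex_minnP => m /asboolP hm m_min; split=> // i'.
  by move=> im hi'; have := m_min i' (asboolT hi'); rewrite leqNgt im.
have spec_uniq z u i j : spec z u i -> spec z u j -> i = j.
  case: i j => [|i] [|j] //=; first by move=> h [/h].
    by move=> [hi _] /(_ i).
  move=> [hi hi'] [hj hj']; suff -> : i = j by [].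
  apply/eqP; rewrite eqn_leq.
  apply/andP; split; rewrite leqNgt; apply/negP => lt; first exact: hi' lt hj.
  exact: hj' lt hi.
have /choice[next' hnext'] : forall p : C * seq nat, exists j, spec p.1 p.2 j.
  by move=> p; exact: spec_ex.
pose next z u := next' (z, u).
have nextE z u j : next z u = j <-> spec z u j.
  split=> [<-|]; first exact: hnext'.
  by apply: spec_uniq; exact: hnext'.
(* A branch outside the closed set [H (size u)] has a prefix whose cylinder misses it, and the code
   of that prefix would be admissible. *)
have meets z u : open_domain z ->
    branches z `&` cyl (Q u) !=set0 -> spec z u 0 ->
    branches z `&` cyl (Q u) `<=` H (size u).
  move=> Dz _ h0 x [zx Qx]; apply: contrapT => nHx.
  have /open_preP/(_ x nHx)[n hn] : open (~` H (size u)).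
    exact: closed_openC.
  have le_m := leq_maxl n (size (Q u)); have le_Q := leq_maxr n (size (Q u)).
  set m := maxn _ _ in le_m le_Q.
  apply: (h0 (pickle (pre m x))); rewrite /ok codeK.
  split=> [y /cyl_preE e|y /cyl_preE e|]; last exact: zx.
  - by rewrite /cyl /= -(pre_le le_Q e).
  - by apply: hn; exact: pre_le e.
have [|||s sB sH] := @greedy_selector open_domain branches H
  (fun u => cyl (Q u)) next branches_closed (fun u => @closed_cyl (Q u)).
- by move=> z Dz; apply/branches_meets_cyl => //; case: Dz => _ [].
- move=> z u Dz hu; have /nextE := erefl (next z u).
  case: (next z u) => [|j] /= => [h0|[[h1 h2 h3] _]].
    by split=> //; exact: meets.
  split=> //; first by apply/branches_meets_cyl.
  by move=> x [_ /h2].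
- move=> u j; apply: Fsigma_rel; case: j => [|j].
    have -> : [set z | next z u = 0] = ~` (\bigcup_i ok u i).
      apply/seteqP; split=> z /=; first by move=> /nextE h [i _ /h].
      by move=> h; apply/nextE => i hi; apply: h; exists i.
    by apply: closed_Fsigma; apply/open_closedC/bigcup_open.
  have -> : [set z | next z u = j.+1] =
      ok u j `&` ~` (\bigcup_(i in [set i | i < j]) ok u i).
    apply/seteqP; split=> z /=.
      by move=> /nextE[h1 h2]; split=> // -[i /h2].
    by move=> [h1 h2]; apply/nextE; split=> // i ij hi; apply: h2; exists i.
  apply: FsigmaI; first exact: open_Fsigma.
  by apply: closed_Fsigma; apply/open_closedC/bigcup_open.
exists open_domain, s; split=> //; first exact: open_domain_Gdelta.
apply/seteqP; split=> z.
  move=> YEz; have Dz := sub_open_domain YEz; split=> //.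
  by case: YEz => Yz Ez; have [] := branches_fiber Yz Ez (sB z Dz).
move=> [Dz Xsz]; split; last by case: Dz.
by rewrite (branches_g Dz (sB z Dz) Xsz); exact: (LCmap_sub gLC).
Qed.

End OpenPiece.

(** * Decomposition into perfect and open pieces *)

Section Decomposition.
Variables (X Y : set C) (g : C -> C).
Hypothesis gLC : clopen_LC_map X Y g.

Lemma perfect_open_pieces : exists E : seq bool -> set C,
  [/\ forall s, closed (E s),
      forall y, Y y -> (forall s, ~ E s y) -> graph_fiber X g y `<=` X &
      forall s t, exists2 O, open O & forall y, Y y -> E s y ->
        (O y <-> (g @` (X `&` cyl t)) y)].
Proof.
pose A t := g @` (X `&` cyl t).
have /choice[OF hOF] t : exists p : set C * set C,
    [/\ open p.1, closed p.2 & A t = Y `&` (p.1 `&` p.2)].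
  by have [O [F ?]] := LCmap_LC gLC (@rel_clopen_cyl X t); exists (O, F).
exists (fun s => closure (A s) `&` ~` (OF s).1); split.
- move=> s; have [? _ _] := hOF s; apply: closedI; first exact: closed_closure.
  exact: open_closedC.
(* If [x] were outside [X], some [cyl (pre n x)] would miss the closed fiber over [y]. Then [y] is
   in the closure of [A (pre n x)] but not in it, which puts [y] in [E (pre n x)]. *)
- move=> y Yy nE x yx; apply: contrapT => nXx.
  have /open_preP/(_ x)[|n hn] : open (~` (X `&` g @^-1` [set y])).
    by apply: closed_openC; exact: (LCmap_fiber gLC).
    by case.
  have nAy : ~ A (pre n x) y.
    by move=> [x' [Xx' /cyl_preE e] gx']; apply: (hn x' e).
  apply: (nE (pre n x)); have [_ clF eA] := hOF (pre n x).
  have clAy : closure (A (pre n x)) y.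
    apply/closure_preP => m; have [x' [Xx' e1 e2]] := yx (maxn m n).
    exists (g x'); last exact: pre_le (leq_maxl _ _) e2.
    exists x' => //; split=> //; apply/cyl_preE.
    exact: pre_le (leq_maxr _ _) e1.
  split=> // Oy; apply: nAy; rewrite eA; split=> //; split=> //.
  apply: clF; apply: closure_subset clAy; rewrite -/(A _) eA.
  by move=> z [_ []].
(* A point [y] of [E s] is not in [A s], so it is in the image of [cyl s] and [cyl t] together iff
   it is in that of [cyl t]. The closed factor [F] contains [A s], hence [y]; only the open factor
   decides. *)
- move=> s t; have [O [F [oO clF eO]]] :=
    LCmap_LC gLC (rel_clopenU (@rel_clopen_cyl X s) (@rel_clopen_cyl X t)).
  exists O => // y Yy [clAy nOy]; have [_ _ eA] := hOF s; split=> [Oy|].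
    have Fy : F y.
      apply: clF; apply: closure_subset clAy => z [x [Xx sx] <-].
      have : (g @` (X `&` (cyl s `|` cyl t))) (g x).
        by exists x => //; split=> //; left.
      by rewrite eO => -[_ []].
    have : (g @` (X `&` (cyl s `|` cyl t))) y by rewrite eO.
    move=> [x [Xx [sx|tx]] gx]; last by exists x.
    have : A s y by exists x.
    by rewrite eA => -[_ []].
  move=> [x [Xx tx] gx].
  have : (g @` (X `&` (cyl s `|` cyl t))) y.
    by exists x => //; split=> //; right.
  by rewrite eO => -[_ []].
Qed.

(** The hypothesis on [Cls] has the form supplied by [class_trace]. The perfect piece is known only
    up to inclusions: it lies in [Y] and contains what the [E t] leave of [Y]. *)
Lemma clopen_LC_decomposition (Cls : set C -> Prop) :
  (exists2 H : nat -> set C, forall k, closed (H k) &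
    forall (D : set C) (s : C -> C), (forall k, rel_Fsigma D (s @^-1` H k)) ->
    exists2 T, Cls T & D `&` s @^-1` X = D `&` T) ->
  exists (E : seq bool -> set C) (D0 T0 : set C) (D T : seq bool -> set C),
    [/\ forall t, closed (E t), closed D0 /\ Cls T0,
        forall t, Gdelta (D t) /\ Cls (T t),
        D0 `&` T0 `<=` Y /\ Y `<=` D0 `&` T0 `|` \bigcup_t E t &
        forall t, Y `&` E t = D t `&` T t].
Proof.
move=> [H Hcl trace]; have [E [Ecl Eperf Eopen]] := perfect_open_pieces.
have [D0 [s0 [D0cl D0H D0P s0P]]] := graph_fiber_selector X g Hcl.
have [T0 T0Cls T0e] := trace D0 s0 D0H.
have /choice[DT hDT] t : exists p : set C * set C,
    [/\ Gdelta p.1, Cls p.2 & Y `&` E t = p.1 `&` p.2].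
  have /(_ _)/cid2 hO := Eopen t.
  have [|||D [s [Dd DH DE]]] :=
    @open_piece_selector X Y g gLC (E t) (fun t => projT1 (hO t)) _ _ _ H Hcl.
  - exact: Ecl.
  - by move=> t'; case: (projT2 (hO t')).
  - by move=> t' y Yy Ey; case: (projT2 (hO t')) => _; apply.
  by have [T hT e] := trace D s DH; exists (D, T); rewrite DE e.
exists E, D0, T0, (fun t => (DT t).1), (fun t => (DT t).2); split=> //.
- by move=> t; have [] := hDT t.
- rewrite -T0e; split=> [z [Dz Xsz]|y Yy].
    by rewrite (graph_fiberE gLC Xsz (s0P z Dz)); exact: (LCmap_sub gLC).
  have [[t Ety]|nE] := pselect (exists t, E t y); [by right; exists t|left].
  have Dy : D0 y.
    apply/D0P; have := Yy; rewrite -(LCmap_onto gLC) => -[x Xx <-].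
    by exists x; exact: graph_fiber_g.
  split=> //; apply: (Eperf y Yy) => [t Ety|]; first by apply: nE; exists t.
  exact: s0P.
- by move=> t; have [] := hDT t.
Qed.

Lemma image_additive (d : Order.disp_t) (W : bOrderType d) (a : W) :
  ord_gt1 a -> borel_additive a X -> borel_additive a Y.
Proof.
move=> a1 hX; have [trA _] := class_trace a.
have [E [D0 [T0 [D [T [Ecl [D0cl hT0] hDT [T0Y YT] eE]]]]]] :=
  clopen_LC_decomposition (trA X hX).
have -> : Y = D0 `&` T0 `|` \bigcup_t (D t `&` T t).
  apply/seteqP; split=> y; last first.
    by move=> [/T0Y//|[t _]]; rewrite -eE => -[].
  move=> Yy; have [|[t _ Ety]] := YT y Yy; [by left|right].
  by exists t => //; rewrite -eE.
apply: additiveU; first by apply: additiveI_Gdelta => //; exact: closed_Gdelta.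
apply: (additive_bigcup [::]) => t; have [? ?] := hDT t.
exact: additiveI_Gdelta.
Qed.

Lemma image_multiplicative (d : Order.disp_t) (W : bOrderType d) (a : W) :
  ord_gt1 a -> borel_multiplicative a X -> borel_multiplicative a Y.
Proof.
move=> a1 hX; have [_ trM] := class_trace a.
have [E [D0 [T0 [D [T [Ecl [D0cl hT0] hDT [T0Y YT] eE]]]]]] :=
  clopen_LC_decomposition (trM X hX).
have mI (G S : set C) : Gdelta G -> borel_multiplicative a S ->
    borel_multiplicative a (G `&` S).
  move=> hG hS; apply: multiplicativeI => //.
  by apply: Gdelta_multiplicative => //; right.
have addI (G S : set C) : Gdelta G -> borel_multiplicative a S ->
    borel_additive a (G `&` ~` S).
  by move=> hG /additiveC hS; exact: additiveI_Gdelta.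
apply/additiveC.
(* A union of pieces could leave the multiplicative class, so the complement is decomposed: off all
   [E t] it is that of the perfect piece, inside [E t] that of the open piece. *)
have -> : ~` Y = (\bigcap_t ~` E t) `&` ~` (D0 `&` T0) `|`
    \bigcup_t (E t `&` ~` (D t `&` T t)).
  apply/seteqP; split=> y.
    move=> nYy; have [[t Ety]|nE] := pselect (exists t, E t y).
      by right; exists t => //; split=> //; rewrite -eE => -[].
    by left; split=> [t _ Ety|/T0Y//]; apply: nE; exists t.
  move=> [[nE nT] Yy|[t _ [Ety nDT]] Yy]; last by apply: nDT; rewrite -eE.
  by have [//|[t _ /(nE t I)]] := YT y Yy.
apply: additiveU.
  apply: addI; last by apply: mI => //; exact: closed_Gdelta.
  apply: (Gdelta_bigcap [::]) => t.
  by apply: open_Gdelta; exact: closed_openC.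
apply: (additive_bigcup [::]) => t; have [? ?] := hDT t.
by apply: addI; [exact: closed_Gdelta|exact: mI].
Qed.

End Decomposition.

(** * Category arguments for Gdelta sets *)

Lemma pre_widen (z : C) u n : cyl u z ->
  [/\ cyl (pre (maxn n (size u)) z) z,
      cyl (pre (maxn n (size u)) z) `<=` cyl u &
      cyl (pre (maxn n (size u)) z) `<=` cyl (pre n z)].
Proof.
move=> uz; split=> [|y /cyl_preE e|y /cyl_preE e]; first exact: cyl_pre.
  by rewrite /cyl /= -(pre_le (leq_maxr _ _) e).
by apply/cyl_preE; exact: pre_le (leq_maxl _ _) e.
Qed.

Lemma Gdelta_local (A : set C) (T : set (seq bool)) :
  (forall t, T t -> Gdelta (A `&` cyl t)) ->
  Gdelta (A `&` \bigcup_(t in T) cyl t).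
Proof.
move=> hT; apply/FsigmaC.
have -> : ~` (A `&` \bigcup_(t in T) cyl t) = ~` (\bigcup_(t in T) cyl t) `|`
    \bigcup_t (if pselect (T t) then cyl t `&` ~` (A `&` cyl t) else set0).
  apply/seteqP; split=> x.
    move=> nAx; have [[t Tt tx]|h] := pselect ((\bigcup_(t in T) cyl t) x).
      right; exists t => //; case: pselect => // ?; split=> // -[Ax _].
      by apply: nAx; split=> //; exists t.
    by left.
  move=> [h [_ /h]//|[t _]]; case: pselect => // Tt [tx nA] [Ax _].
  exact: nA.
apply: FsigmaU.
  apply/closed_Fsigma/open_closedC/bigcup_open => t _; exact: open_cyl.
apply: (Fsigma_bigcup [::]) => t; case: pselect => [Tt|?].
  by apply: FsigmaI; [apply/closed_Fsigma/closed_cyl|apply/FsigmaC/hT].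
by apply: closed_Fsigma; exact: closed0.
Qed.

(** All cylinders in which [A] is Gdelta are removed. The removed part of [A] is Gdelta, so
    something remains; a cylinder in which the remainder is Gdelta would itself have been
    removed. *)
Lemma Gdelta_kernel (A : set C) : ~ Gdelta A -> exists B : set C,
  [/\ closed B, A `&` B !=set0 &
      forall u, A `&` B `&` cyl u !=set0 -> ~ Gdelta (A `&` B `&` cyl u)].
Proof.
move=> nGA; pose T : set (seq bool) := [set t | Gdelta (A `&` cyl t)].
pose W := \bigcup_(t in T) cyl t.
have GW : Gdelta (A `&` W) by exact: Gdelta_local.
have oW : open W by apply: bigcup_open => t _; exact: open_cyl.
exists (~` W); split; first exact: open_closedC.
  apply/set0P/eqP => A0; apply: nGA; rewrite -(setIT A) -(setUv W) setIUr A0.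
  by rewrite setU0.
move=> u [x [[Ax nWx] ux]] Gu; apply: nWx; exists u => //; rewrite /T /=.
have -> : A `&` cyl u = A `&` W `&` cyl u `|` A `&` ~` W `&` cyl u.
  by rewrite -setIUl -setIUr setUv setIT.
by apply: GdeltaU => //; apply: GdeltaI => //; exact/open_Gdelta/open_cyl.
Qed.

(** Baire's theorem for relatively closed sets [R i]. If it failed, a chain of cylinders entering
    [O k] and leaving [R k] at step [k] would converge to a point of [G] in no [R i]. *)
Lemma Gdelta_Baire (G : set C) (R : nat -> set C) :
  Gdelta G -> G !=set0 -> G `<=` \bigcup_i R i ->
  (forall i x, G x -> ~ R i x ->
    exists n, forall x', G x' -> pre n x = pre n x' -> ~ R i x') ->
  exists v i, G `&` cyl v !=set0 /\ G `&` cyl v `<=` R i.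
Proof.
move=> [O oO eG] [x0 Gx0] GR Rcl; apply: contrapT => none.
have step (k : nat) v : exists w, G `&` cyl v !=set0 ->
    [/\ G `&` cyl w !=set0, cyl w `<=` cyl v, cyl w `<=` O k &
        forall x, G x -> cyl w x -> ~ R k x].
  have [Gv|nGv] := pselect (G `&` cyl v !=set0); last by exists v.
  have [x [[Gx vx] nRx]] : exists x, (G `&` cyl v) x /\ ~ R k x.
    apply: contrapT => h; apply: none; exists v, k; split=> // x Gvx.
    by apply: contrapT => nRx; apply: h; exists x.
  have [n hn] := Rcl k x Gx nRx.
  have Ox : O k x by move: Gx; rewrite eG; apply.
  have /open_preP/(_ x Ox)[m hm] := oO k.
  have [h1 h2 h3] := @pre_widen x v (maxn n m) vx; set w := pre _ _ in h1 h2 h3.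
  exists w => _; split=> //.
  - by exists x.
  - by move=> y /h3/cyl_preE e; apply: hm; exact: pre_le (leq_maxr _ _) e.
  - move=> y Gy /h3/cyl_preE e; apply: (hn y Gy).
    exact: pre_le (leq_maxl _ _) e.
have /choice[f hf] : forall p : nat * seq bool, exists w,
    G `&` cyl p.2 !=set0 -> [/\ G `&` cyl w !=set0, cyl w `<=` cyl p.2,
      cyl w `<=` O p.1 & forall x, G x -> cyl w x -> ~ R p.1 x].
  by move=> p; exact: step.
pose s := fix s k := if k is k'.+1 then f (k', s k') else [::].
have sG k : G `&` cyl (s k) !=set0.
  by elim: k => [|k /(hf (k, s k))[]//]; exists x0.
have [k|x hx] := @cyl_chain s; first by have [_] := hf (k, s k) (sG k).
have Gx : G x.
  by rewrite eG => k _; have [_ _ h _] := hf (k, s k) (sG k); exact/h/(hx k.+1).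
have [i _ Rx] := GR x Gx.
by have [_ _ _ h] := hf (i, s i) (sG i); apply: (h x Gx _ Rx); exact: hx i.+1.
Qed.

(** * Restriction to the preimage of a closed set *)

Section Restriction.
Variables (X Y : set C) (g : C -> C).
Hypothesis gLC : clopen_LC_map X Y g.
Variable B : set C.
Hypothesis B_closed : closed B.

Lemma preimage_rel_closed x : X x -> ~ B (g x) ->
  exists n, forall x', X x' -> pre n x = pre n x' -> ~ B (g x').
Proof.
move=> Xx nBx; have /open_preP/(_ _ nBx)[n hn] : open (~` B).
  exact: closed_openC.
have [m hm] := LCmap_cont gLC n Xx.
by exists m => x' Xx' e; exact: hn (hm x' Xx' e).
Qed.

Lemma preimage_closed_Gdelta : Gdelta X -> Gdelta (X `&` g @^-1` B).
Proof.
move=> GX.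
have -> : X `&` g @^-1` B = X `&` closure (X `&` g @^-1` B).
  apply/seteqP; split=> x [Xx].
    by move=> Bx; split=> //; exact: subset_closure.
  move=> /closure_preP clx; split=> //; apply: contrapT => nBx.
  have [n hn] := preimage_rel_closed Xx nBx.
  by have [x' [Xx' Bx'] e] := clx n; exact: hn Bx'.
by apply: GdeltaI => //; apply: closed_Gdelta; exact: closed_closure.
Qed.

(* Whether [x] belongs to the extension of [U] is read off the shortest prefix
   of [x] whose cylinder meets [X `&` g @^-1` B] inside [U] or outside [U]. *)
Lemma rel_clopen_extension U : rel_clopen (X `&` g @^-1` B) U ->
  exists2 V, rel_clopen X V & forall x, X x -> B (g x) -> (V x <-> U x).
Proof.
move=> hU; set P := X `&` g @^-1` B in hU.
pose inU t := P `&` cyl t `<=` U; pose outU t := P `&` cyl t `<=` ~` U.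
pose decided t : bool := `[< inU t \/ outU t >].
have dec x : X x -> exists n, decided (pre n x).
  move=> Xx; have [Bx|nBx] := pselect (B (g x)); last first.
    have [n hn] := preimage_rel_closed Xx nBx.
    exists n; apply/asboolP; left=> y [[Xy By] /cyl_preE e].
    by case: (hn y Xy e).
  have [n hn] := hU x (conj Xx Bx); exists n; apply/asboolP.
  have [Ux|nUx] := pselect (U x); [left|right].
    by move=> y [Py /cyl_preE e]; apply/(hn y Py e).
  by move=> y [Py /cyl_preE e] /(hn y Py e).
pose V := [set x | exists n, [/\ decided (pre n x), inU (pre n x) &
  forall m, m < n -> ~~ decided (pre m x)]].
have V_pre x x' n : pre n x = pre n x' -> decided (pre n x) -> V x -> V x'.
  move=> e dn [k [dk ik k_min]].
  have kn : k <= n by rewrite leqNgt; apply/negP => /k_min; rewrite dn.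
  have ek m : m <= n -> pre m x' = pre m x by move=> mn; exact/esym/(pre_le mn).
  exists k; rewrite ek //; split=> // m mk; rewrite ek; first exact: k_min.
  exact: leq_trans (ltnW mk) kn.
exists V => [x Xx|x Xx Bx].
  have [n dn] := dec x Xx; exists n => x' Xx' e.
  by split; apply: (V_pre _ _ n) => //; rewrite -e.
split=> [[n [_ + _]]|Ux]; first by apply; split=> //; exact: cyl_pre.
have ex := dec x Xx; exists (ex_minn ex); case: ex_minnP => n dn n_min.
split=> //.
  have /asboolP[//|out] := dn; exfalso.
  by apply: (out x) => //; split=> //; exact: cyl_pre.
by move=> m mn; apply/negP => /n_min; rewrite leqNgt mn.
Qed.

(** Fibers over [B] are kept whole. A relatively clopen [U] extends to [X], and its image is the
    image of the extension cut down to [B]. *)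
Lemma LCmap_restriction : clopen_LC_map (X `&` g @^-1` B) (Y `&` B) g.
Proof.
split.
- rewrite -(LCmap_onto gLC); apply/seteqP; split=> y.
    by move=> [x [Xx Bx] <-]; split=> //; exists x.
  by move=> [[x Xx <-] Bx]; exists x.
- move=> x n [Xx _]; have [m hm] := LCmap_cont gLC n Xx.
  by exists m => x' [Xx' _]; exact: hm.
- move=> y; have [By|nBy] := pselect (B y).
    have -> : X `&` g @^-1` B `&` g @^-1` [set y] = X `&` g @^-1` [set y].
      apply/seteqP; split=> x; first by move=> [[]].
      by move=> [Xx /= gx]; do !split=> //=; rewrite gx.
    exact: (LCmap_fiber gLC).
  have -> : X `&` g @^-1` B `&` g @^-1` [set y] = set0.
    by apply/seteqP; split=> x // -[[_ /=] + /= gx]; rewrite gx.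
  exact: closed0.
- move=> U /rel_clopen_extension[V hV VU].
  have [O [F [oO clF e]]] := LCmap_LC gLC hV; exists O, F; split=> //.
  rewrite [RHS]setIAC -e; apply/seteqP; split=> y.
    move=> [x [[Xx Bx] Ux] <-]; split=> //; exists x => //; split=> //.
    exact/VU.
  move=> [[x [Xx Vx] <-] Bx]; exists x => //; do !split=> //; exact/VU.
Qed.

End Restriction.

(** * Nowhere density relative to a subset *)

Section NowhereDense.
Variable Z : set C.

Definition hits u := Z `&` cyl u !=set0.

Definition nowhere_dense_in (A : set C) := forall u, hits u ->
  exists v, [/\ hits v, cyl v `<=` cyl u & forall z, Z z -> cyl v z -> ~ A z].

Lemma nowhere_denseS A A' :
  A `<=` A' -> nowhere_dense_in A' -> nowhere_dense_in A.
Proof.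
move=> AA' h u /h[v [hv vu vA]]; exists v; split=> // z Zz vz /AA'.
exact: vA.
Qed.

Lemma nowhere_dense0 : nowhere_dense_in set0.
Proof. by move=> u hu; exists u; split=> // z _ _ []. Qed.

Lemma nowhere_denseU A A' : nowhere_dense_in A -> nowhere_dense_in A' ->
  nowhere_dense_in (A `|` A').
Proof.
move=> h h' u /h[v [/h'[w [hw wv wA']] vu vA]]; exists w; split=> //.
  exact: subset_trans wv vu.
by move=> z Zz wz [|]; [apply: vA => //; exact: wv|exact: wA'].
Qed.

Lemma nowhere_dense_size n (F : seq bool -> set C) :
  (forall t, size t = n -> nowhere_dense_in (F t)) ->
  nowhere_dense_in (\bigcup_(t in [set t | size t = n]) F t).
Proof.
elim: n F => [|n IHn] F hF.
  apply: nowhere_denseS (hF [::] erefl) => z [t /= /size0nil -> //].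
have h b := IHn (fun t => F (b :: t)) (fun t e => hF (b :: t) (congr1 S e)).
apply: nowhere_denseS (nowhere_denseU (h true) (h false)) => z [[|b t] //=].
by move=> [e] Fz; case: b Fz => Fz; [left|right]; exists t.
Qed.

Lemma nowhere_dense_lt n (F : nat -> set C) :
  (forall i, nowhere_dense_in (F i)) ->
  nowhere_dense_in (\bigcup_(i in [set i | i < n]) F i).
Proof.
move=> hF; elim: n => [|n IHn].
  by apply: nowhere_denseS nowhere_dense0 => z [].
apply: nowhere_denseS (nowhere_denseU IHn (hF n)) => z [i /= + Fz].
rewrite ltnS leq_eqVlt => /predU1P[<-|lt_in]; [by right|left].
by exists i.
Qed.

End NowhereDense.

(** * Images of locally small sets and the Baire argument *)

Section Category.
Variables (X Y : set C) (g : C -> C).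
Hypothesis gLC : clopen_LC_map X Y g.

Let nd := nowhere_dense_in Y.

Section Levels.
Variable V : set C.
Hypothesis V_clopen : rel_clopen X V.
Hypothesis V_nd : forall x, X x -> V x ->
  exists n, nd (g @` (X `&` cyl (pre n x))).

Let small t := nd (g @` (X `&` cyl t)) /\ X `&` cyl t `<=` V.

(** Points are sorted by the length of their shortest small prefix; on [X] the levels partition [V]
    into relatively clopen sets. *)
Let level n : set C :=
  [set x | small (pre n x) /\ forall m, m < n -> ~ small (pre m x)].

Let level_pre n x x' : pre n x = pre n x' -> level n x -> level n x'.
Proof.
move=> e [sx x_min]; split; first by rewrite -e.
by move=> m mn; rewrite -(pre_le (ltnW mn) e); exact: x_min.
Qed.

Let level_uniq m n x : level m x -> level n x -> m = n.
Proof.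
move=> [sm m_min] [sn n_min]; apply/eqP; rewrite eqn_leq.
apply/andP; split; rewrite leqNgt; apply/negP => lt.
  exact: m_min lt sn.
exact: n_min lt sm.
Qed.

Let level_sub n x : X x -> level n x -> V x.
Proof. by move=> Xx [[_ +] _]; apply; split=> //; exact: cyl_pre. Qed.

Let level_ex x : X x -> V x -> exists n, level n x.
Proof.
move=> Xx Vx; have [m hm] := V_clopen Xx; have [n hn] := V_nd Xx Vx.
have hs : small (pre (maxn m n) x).
  split; last first.
    move=> y [Xy /cyl_preE e].
    by apply/(hm y Xy) => //; exact: pre_le (leq_maxl _ _) e.
  apply: nowhere_denseS hn => _ [y [Xy /cyl_preE e] <-].
  exists y => //; split=> //; apply/cyl_preE.
  exact: pre_le (leq_maxr _ _) e.
have ex : exists k, `[< small (pre k x) >].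
  by exists (maxn m n); apply/asboolP.
exists (ex_minn ex); case: ex_minnP => k /asboolP sk k_min; split=> // i ik.
by move=> /asboolT/k_min; rewrite leqNgt ik.
Qed.

(** Within [X], level [n] is covered by the finitely many small cylinders of length [n]. *)
Let level_nd n : nd (g @` (X `&` level n)).
Proof.
pose F t := [set y | small t /\ (g @` (X `&` cyl t)) y].
apply: (@nowhere_denseS _ _ (\bigcup_(t in [set t | size t = n]) F t)).
  move=> _ [x [Xx [sx _]] <-]; exists (pre n x); first exact: size_pre.
  by split=> //; exists x => //; split=> //; exact: cyl_pre.
apply: nowhere_dense_size => t _; have [st|nst] := pselect (small t).
  by apply: nowhere_denseS (st.1) => y [].
by apply: nowhere_denseS (@nowhere_dense0 Y) => y [].
Qed.

Let levels_nd n : nd (\bigcup_(i in [set i | i < n]) (g @` (X `&` level i))).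
Proof. exact: nowhere_dense_lt. Qed.

(** Points of unbounded level in the compact fiber would cluster at a fiber point [x]. But near [x]
    the level is constant if [x] is in [V], and there is none otherwise. *)
Let fiber_levels y : exists m, forall x n,
  X x -> g x = y -> level n x -> n < m.
Proof.
apply: contrapT => none.
pose Q m := [set x | [/\ X x, g x = y & exists2 n, m <= n & level n x]].
have Qdec m : Q m.+1 `<=` Q m.
  by move=> x [Xx gx [n mn hn]]; split=> //; exists n => //; exact: ltnW.
have [m|x hx] := decreasing_cluster Qdec.
  apply: contrapT => Q0; apply: none; exists m => x n Xx gx hn.
  rewrite ltnNge; apply/negP => mn; apply: Q0; exists x.
  by split=> //; exists n.
have [Xx gx] : (X `&` g @^-1` [set y]) x.
  apply: (@LCmap_fiber _ _ _ gLC y); apply: closure_subset (hx 0) => x'.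
  by move=> [].
have [Vx|nVx] := pselect (V x).
  have [k hk] := level_ex Xx Vx.
  have /closure_preP/(_ k)[x' [Xx' _ [n kn hn]] e] := hx k.+1.
  by have := level_uniq (level_pre e hk) hn; move=> ek; rewrite ek ltnn in kn.
have [k hk] := V_clopen Xx.
have /closure_preP/(_ k)[x' [Xx' _ [n _ hn]] e] := hx 0.
by apply: nVx; apply/(hk x' Xx' e); exact: level_sub hn.
Qed.

Section DenseCodense.
Variable u : seq bool.
Hypothesis V_dense : forall v, hits Y v -> cyl v `<=` cyl u ->
  exists y, [/\ Y y, cyl v y & (g @` (X `&` V)) y].

(** First [b] is chosen off the images of the levels up to [M]; its fiber has bounded levels.
    Density of the image of [V] then gives a value off all lower images, attained at a level [i]
    beyond those of [b]. *)
Let separate M v : hits Y v -> cyl v `<=` cyl u -> exists i, [/\ M < i,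
  exists x, [/\ X x, cyl v (g x) & level i x] &
  exists b, [/\ Y b, cyl v b, forall x n, X x -> g x = b -> level n x ->
    M < n & forall x n, X x -> g x = b -> level n x -> n < i]].
Proof.
move=> hv vu; have [v1 [[b [Yb v1b]] v1v v1_lt]] := @levels_nd M.+1 v hv.
have [m hm] := fiber_levels b.
have [v2 [hv2 v2v v2_lt]] := @levels_nd (maxn m M.+1) v hv.
have [a [_ + [x [Xx Vx] e]]] := V_dense hv2 (subset_trans v2v vu).
rewrite -{}e => v2a.
have [i hi] := level_ex Xx Vx.
have i_lt : maxn m M.+1 <= i.
  rewrite leqNgt; apply/negP => lt; apply: (v2_lt (g x)) => //.
    exact: (LCmap_sub gLC).
  by exists i => //; exists x.
exists i; split.
- by apply: leq_trans i_lt; exact: leq_maxr.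
- by exists x; split=> //; exact: v2v.
exists b; split=> //; first exact: v1v.
  move=> x' n Xx' gx' hn; rewrite ltnNge; apply/negP => nM.
  by apply: (v1_lt b) => //; exists n => //; exists x'.
move=> x' n Xx' gx' hn; apply: leq_trans (hm x' n Xx' gx' hn) _.
by apply: leq_trans i_lt; exact: leq_maxl.
Qed.

(* Every fiber meets only finitely many levels, so the levels can be picked one
   after the other, each new one beyond all those met by the fibers of the
   points [b] that the image has to avoid. *)
Let dense_codense : hits Y u -> exists U, [/\ rel_clopen X U,
  forall v, hits Y v -> cyl v `<=` cyl u ->
    exists x, [/\ X x, U x & cyl v (g x)] &
  forall v, hits Y v -> cyl v `<=` cyl u ->
    exists b, [/\ Y b, cyl v b & ~ (g @` (X `&` U)) b]].
Proof.
move=> hu; pose ok v := hits Y v /\ cyl v `<=` cyl u.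
have /choice[f hf] : forall p : nat * seq bool, exists i, ok p.2 ->
  [/\ p.1 < i,
  exists x, [/\ X x, cyl p.2 (g x) & level i x] &
  exists b, [/\ Y b, cyl p.2 b, forall x n, X x -> g x = b -> level n x ->
    p.1 < n & forall x n, X x -> g x = b -> level n x -> n < i]].
  move=> [M v]; have [[hv vu]|nok] := pselect (ok v); last by exists 0.
  by have [i hi] := separate M hv vu; exists i.
(* Enumerates the cylinders inside [cyl u] that meet [Y], with [u] as default. *)
pose v k := if pselect (ok (odflt [::] (unpickle k))) then
  odflt [::] (unpickle k) else u.
have v_ok k : ok (v k) by rewrite /v; case: pselect => // ?; split.
have v_surj w : ok w -> exists k, v k = w.
  move=> hw; exists (pickle w); rewrite /v; by rewrite pickleK; case: pselect.
pose M := fix M k := if k is k'.+1 then f (M k', v k') else 0.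
have M_lt k : M k < M k.+1 by have [] := hf (M k, v k) (v_ok k).
have M_le j k : j <= k -> M j <= M k.
  by move=> /subnK <-; elim: (k - j) => // i /leq_trans; apply; exact: ltnW.
exists [set x | exists k, level (M k.+1) x]; split.
- move=> x Xx; have [Vx|nVx] := pselect (V x).
    have [n hn] := level_ex Xx Vx; exists n => x' Xx' e.
    have hn' := level_pre e hn.
    by split=> -[k hk]; exists k;
      [rewrite -(level_uniq hn hk)|rewrite -(level_uniq hn' hk)].
  have [n hn] := V_clopen Xx; exists n => x' Xx' e; split=> -[k hk].
    by case: nVx; exact: level_sub hk.
  by case: nVx; apply/(hn x' Xx' e); exact: level_sub hk.
- move=> w hw wu; have [k <-] := v_surj w (conj hw wu).
  have [_ [x [Xx vx hx]] _] := hf (M k, v k) (v_ok k).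
  by exists x; split=> //; exists k.
- move=> w hw wu; have [k <-] := v_surj w (conj hw wu).
  have [_ _ [b [Yb vb b_gt b_lt]]] := hf (M k, v k) (v_ok k).
  (* The levels over [b] lie strictly between the consecutive values [M k] and [M k.+1], so none of
     them was picked. *)
  exists b; split=> // -[x [Xx [j hj]] gx].
  have [jk|kj] := ltnP j k.
    by have := b_gt x _ Xx gx hj; rewrite ltnNge M_le.
  by have := b_lt x _ Xx gx hj; rewrite ltnNge (M_le k.+1 j.+1).
Qed.

(** If the image of [U] is [O] and [F] within [Y], density puts all of [Y] in [cyl u] into [F]. Near
    one of its points in [cyl u] the image then contains all of [Y], against codensity. *)
Lemma not_dense_codense : ~ hits Y u.
Proof.
move=> hu; have [U [hU U_dense U_codense]] := dense_codense hu.
have [O [F [/open_preP oO clF e]]] := LCmap_LC gLC hU.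
have YF z : Y z -> cyl u z -> F z.
  move=> Yz uz; apply: clF; apply/closure_preP => n.
  have [zw wu wn] := @pre_widen z u n uz.
  have [|x [Xx Ux /wn/cyl_preE ex]] := U_dense _ _ wu; first by exists z.
  exists (g x) => //.
  have : (g @` (X `&` U)) (g x) by exists x.
  by rewrite e => -[_ []].
have [|x [Xx Ux ux]] := U_dense u hu; first by [].
have : (g @` (X `&` U)) (g x) by exists x.
rewrite e => -[Ygx [/oO[n hn] _]].
have [xw wu wn] := @pre_widen (g x) u n ux.
have [|b [Yb wb]] := U_codense _ _ wu; first by exists (g x).
apply; rewrite e; split=> //; split; last by apply: YF => //; exact: wu.
by apply: hn; apply/cyl_preE; exact: wn.
Qed.

End DenseCodense.

Lemma locally_nowhere_dense_image : nd (g @` (X `&` V)).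
Proof.
apply: contrapT => /existsNP[u /not_implyP[hu none]].
apply: (@not_dense_codense u) => // v hv vu; apply: contrapT => h.
apply: none; exists v; split=> // z Yz vz gz; apply: h.
by exists z.
Qed.

End Levels.

Lemma nowhere_Gdelta_empty (E : nat -> set C) :
  Gdelta X -> Y `<=` \bigcup_s E s -> (forall s, closed (E s)) ->
  (forall s, Gdelta (Y `&` E s)) ->
  (forall u, Y `&` cyl u !=set0 -> ~ Gdelta (Y `&` cyl u)) -> Y = set0.
Proof.
move=> GX YE Ecl GE Ynot; apply: contrapT => /eqP/set0P Y0.
have hits0 : hits Y [::] by have [y Yy] := Y0; exists y.
(* A part of [Y] inside [E s] would be Gdelta; thus each [E s] is nowhere dense in [Y]. *)
have E_escape s u : hits Y u -> exists z, [/\ Y z, cyl u z & ~ E s z].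
  move=> hu; apply: contrapT => h; apply: (Ynot u hu).
  have -> : Y `&` cyl u = Y `&` E s `&` cyl u.
    apply/seteqP; split=> z; last by move=> [[]].
    by move=> [Yz uz]; split=> //; split=> //; apply: contrapT => nEz;
      apply: h; exists z.
  by apply: GdeltaI => //; exact/open_Gdelta/open_cyl.
pose N := [set x | exists n, nd (g @` (X `&` cyl (pre n x)))].
have oN : open N.
  apply/open_preP => x [n hn]; exists n => y e.
  by exists n; rewrite -e.
have GXN : Gdelta (X `&` ~` N).
  by apply: GdeltaI => //; apply: closed_Gdelta; exact: open_closedC.
have XN0 : X `&` ~` N !=set0.
  apply: contrapT => XN.
  have : nd (g @` (X `&` setT)).
    apply: locally_nowhere_dense_image => [x _|x Xx _]; first by exists 0.
    by apply: contrapT => nNx; apply: XN; exists x.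
  rewrite setIT (LCmap_onto gLC) => /(_ [::] hits0)[v [[z [Yz vz]] _]].
  by move=> /(_ z Yz vz).
have [||v [s [[x [[Xx nNx] vx]] vE]]] :=
  @Gdelta_Baire (X `&` ~` N) (fun s => g @^-1` E s) GXN XN0.
- move=> x [Xx _]; have [|s _ Es] := YE (g x); first exact: (LCmap_sub gLC).
  by exists s.
- move=> s x [Xx _] nEx; have [n hn] := preimage_rel_closed gLC (Ecl s) Xx nEx.
  by exists n => x' [Xx' _]; exact: hn.
(* The contradiction is that [cyl v] has a nowhere dense image: over a cylinder [w] missing [E s],
   its points in [X] all lie in [N]. *)
apply: nNx; exists (size v); rewrite -(cylE vx) => u hu.
have [z [Yz uz nEz]] := E_escape s u hu.
have /open_preP/(_ z nEz)[n hn] : open (~` E s) by exact: closed_openC.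
have [zw wu wn] := @pre_widen z u n uz; set w := pre _ _ in zw wu wn.
have hw : hits Y w by exists z.
have : nd (g @` (X `&` (cyl v `&` g @^-1` cyl w))).
  apply: locally_nowhere_dense_image.
    move=> x1 Xx1; have [m hm] := LCmap_cont gLC (size w) Xx1.
    exists (maxn m (size v)) => x2 Xx2 e.
    have ev := pre_le (leq_maxr _ _) e.
    have ew := hm x2 Xx2 (pre_le (leq_maxl _ _) e).
    by rewrite /cyl /= ev ew.
  move=> x1 Xx1 [vx1 wx1]; apply: contrapT => nNx1.
  have := vE x1 (conj (conj Xx1 nNx1) vx1).
  by apply: hn; apply/cyl_preE/wn.
move=> /(_ w hw)[w' [hw' w'w w'P]]; exists w'; split=> //.
  exact: subset_trans w'w wu.
move=> y Yy w'y [x1 [Xx1 vx1] e]; apply: (w'P y Yy w'y).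
by exists x1 => //; split=> //; split=> //=; rewrite e; exact: w'w.
Qed.

End Category.

Lemma image_Gdelta (X Y : set C) (g : C -> C) :
  clopen_LC_map X Y g -> Gdelta X -> Gdelta Y.
Proof.
move=> gLC GX.
have [|E [D0 [T0 [Dt [T [Ecl [D0cl GT0] hDT [T0Y YT] eE]]]]]] :=
  clopen_LC_decomposition gLC (Cls := Gdelta).
  have [O oO ->] := GX; exists (fun n => ~` O n).
    by move=> n; apply: open_closedC.
  move=> D s /(_ _)/cid2 hP; exists (\bigcap_n ~` projT1 (hP n)).
    by apply: (Gdelta_bigcap 0) => n; apply/GdeltaC; case: (projT2 (hP n)).
  rewrite preimage_bigcap; apply/seteqP; split=> x [Dx hx]; split=> // n _.
    move=> Px; have [_ e] := projT2 (hP n).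
    have : (D `&` projT1 (hP n)) x by [].
    by rewrite -e => -[_]; apply; exact: hx.
  apply: contrapT => nOx; have [_ e] := projT2 (hP n).
  have : (D `&` s @^-1` (~` O n)) x by [].
  by rewrite e => -[_]; exact: hx n I.
have [Q oQ eQ] : Gdelta (D0 `&` T0).
  by apply: GdeltaI => //; exact: closed_Gdelta.
have GYE t : Gdelta (Y `&` E t).
  by rewrite eE; have [? ?] := hDT t; exact: GdeltaI.
(* Off [Q k] the set [Y] is covered by the [E t]. A failure would leave a kernel on which the Baire
   argument, applied to the restricted map, is contradictory. *)
have GYQ k : Gdelta (Y `&` ~` Q k).
  apply: contrapT => /Gdelta_kernel[B [Bcl B0 Bnot]].
  have BQcl : closed (~` Q k `&` B).
    by apply: closedI => //; apply: open_closedC.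
  have gLC' := LCmap_restriction gLC BQcl.
  move: B0 Bnot; rewrite -setIA => /set0P/eqP B0 Bnot; apply: B0.
  apply: (nowhere_Gdelta_empty (E := enum_with [::] E) gLC') => //.
  - exact: (preimage_closed_Gdelta gLC BQcl).
  - rewrite bigcup_enum_with => y [Yy [nQy _]].
    by have [|//] := YT y Yy; rewrite eQ => /(_ k I).
  - by move=> n; have [t ->] := enum_withP [::] E n; exact: Ecl.
  - move=> n; have [t ->] := enum_withP [::] E n; rewrite setIAC.
    by apply: GdeltaI => //; exact: closed_Gdelta.
apply/FsigmaC.
have -> : ~` Y = \bigcup_k (~` Q k `&` ~` (Y `&` ~` Q k)).
  apply/seteqP; split=> y.
    move=> nYy; have [k nQ] : exists k, ~ Q k y.
      apply: contrapT => h; apply: nYy; apply: T0Y; rewrite eQ => k _.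
      by apply: contrapT => nQ; apply: h; exists k.
    by exists k => //; split=> // -[].
  by move=> [k _ [nQ nYQ] Yy]; apply: nYQ.
apply: (Fsigma_bigcup 0) => k; apply: FsigmaI; last exact/FsigmaC.
by apply/closed_Fsigma/open_closedC.
Qed.

(** * Passing from subspaces to the ambient space *)

Section Subtypes.
Variables (X Y : set C) (f : X -> Y).

Definition ambient_map (x : C) : C :=
  if pselect (X x) is left Xx then val (f (exist _ x (mem_set Xx))) else x.

Lemma ambient_mapE (x : X) : ambient_map (val x) = val (f x).
Proof.
rewrite /ambient_map; case: pselect => [Xx|nXx]; last first.
  by case: nXx; exact: set_valP.
by congr (val (f _)); exact: val_inj.
Qed.

Lemma open_subtypeP (Z : set C) (V : set Z) :
  open V <-> exists2 W, open W & V = val @^-1` W.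
Proof. by split=> -[W oW e]; exists W => //; rewrite -e. Qed.

Lemma rel_clopen_open (U : set C) :
  rel_clopen X U -> open (val @^-1` U : set X).
Proof.
move=> hU; apply/open_subtypeP.
exists (\bigcup_(t in [set t | X `&` cyl t `<=` U]) cyl t).
  by apply: bigcup_open => t _; exact: open_cyl.
apply/seteqP; split=> x /=; last first.
  by move=> [t tU tx]; apply: tU; split=> //; exact: set_valP.
move=> Ux; have [n hn] := hU _ (set_valP x).
exists (pre n (val x)); last exact: cyl_pre.
by move=> y [Xy /cyl_preE e]; apply/(hn y Xy e).
Qed.

Lemma ambient_clopen_LC : continuous f -> clopen_LC f -> range f = [set: Y] ->
  (forall y : Y, compact (f @^-1` [set y])) -> clopen_LC_map X Y ambient_map.
Proof.
move=> f_cont f_LC f_onto f_fib; split.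
- apply/seteqP; split=> y.
    move=> [x Xx <-]; rewrite (ambient_mapE (exist _ x (mem_set Xx))).
    exact: set_valP.
  move=> Yy; have : range f (exist _ y (mem_set Yy)) by rewrite f_onto.
  move=> [x _ e]; exists (val x); first exact: set_valP.
  by rewrite ambient_mapE e.
- move=> x n Xx; set x' : X := exist _ x (mem_set Xx).
  have : open (f @^-1` (val @^-1` cyl (pre n (ambient_map x)))).
    move/continuousP: f_cont; apply; apply/open_subtypeP.
    by exists (cyl (pre n (ambient_map x))) => //; exact: open_cyl.
  move=> /open_subtypeP[W /open_preP oW e].
  have Wx : W x.
    have : (val @^-1` W) x'.
      by rewrite -e /= -ambient_mapE; exact: cyl_pre.
    by [].
  have [m hm] := oW x Wx; exists m => y Xy /hm Wy.
  have : (val @^-1` W) (exist _ y (mem_set Xy) : X) by [].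
  by rewrite -e /= -ambient_mapE => /cyl_preE.
- move=> y; have [Yy|nYy] := pselect (Y y); last first.
    have -> : X `&` ambient_map @^-1` [set y] = set0.
      apply/seteqP; split=> x // [Xx /= e]; apply: nYy; rewrite -e.
      rewrite (ambient_mapE (exist _ x (mem_set Xx))); exact: set_valP.
    exact: closed0.
  have -> : X `&` ambient_map @^-1` [set y] =
      val @` (f @^-1` [set (exist _ y (mem_set Yy) : Y)]).
    apply/seteqP; split=> x.
      move=> [Xx /= e]; exists (exist _ x (mem_set Xx)) => //=.
      by apply: val_inj; rewrite -ambient_mapE.
    move=> [x' /= e <-]; split; first exact: set_valP.
    by rewrite /= ambient_mapE e.
  (* The fiber is the image of a compact set under the continuous inclusion into a Hausdorff
     space. *)
  apply: compact_closed; first exact: cantor_space_hausdorff.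
  apply: continuous_compact (f_fib _).
  apply: continuous_subspaceT; exact: initial_continuous.
- move=> U hU.
  have hUC : rel_clopen X (~` U).
    move=> x Xx; have [n hn] := hU x Xx; exists n => x' Xx' e.
    by split=> nU /(hn x' Xx' e).
  have : clopen (val @^-1` U : set X).
    split; first exact: rel_clopen_open.
    rewrite -openC preimage_setC; exact: rel_clopen_open.
  move=> /f_LC[O [F [/open_subtypeP[O' oO' eO] clF e]]].
  have /open_subtypeP[W oW eW] : open (~` F) by exact: closed_openC.
  exists O', (~` W); split=> //; first exact: open_closedC.
  have fE (y : Y) : (f @` (val @^-1` U)) y <-> O' (val y) /\ ~ W (val y).
    have eF : F = val @^-1` (~` W) by rewrite -preimage_setC -eW setCK.
    by rewrite e eO eF.
  apply/seteqP; split=> y.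
    move=> [x [Xx Ux] <-]; rewrite (ambient_mapE (exist _ x (mem_set Xx))).
    split; first exact: set_valP.
    by apply/fE; exists (exist _ x (mem_set Xx)).
  move=> [Yy /(fE (exist _ y (mem_set Yy)))[x Ux e']].
  exists (val x); first by split=> //; exact: set_valP.
  by rewrite ambient_mapE e'.
Qed.

End Subtypes.

Local Open Scope order_scope.

Theorem theorem2 (X Y : set cantor_space) (f : X -> Y)
  (f_cont : continuous f)
  (f_clopen_LC : clopen_LC f)
  (f_onto : range f = [set: Y])
  (f_fibers : forall y : Y, compact (f @^-1` [set y]))
  (d : Order.disp_t) (W : bOrderType d)
  (W_wo : well_order (<=%O : rel W))
  (alpha : W)
  (alpha_ge1 : \bot < alpha)
  (alpha_lt_omega1 : countable [set b : W | b < alpha]) :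
  (borel_additive alpha X -> borel_additive alpha Y) /\
  (borel_multiplicative alpha X -> borel_multiplicative alpha Y).
Proof.
have gLC := ambient_clopen_LC f_cont f_clopen_LC f_onto f_fibers.
split=> hX.
  (* Class 1 is separate: an Fsigma set [X] is a union of compact sets, and these have closed
     images. *)
  have [a1|a1] := additive_ge1 hX; last exact: (image_additive gLC a1 hX).
  have /additiveP[[_ [H Hcl eX]]|[a2]] := hX; last by case: (ord_is1_gt1 a1 a2).
  apply: Borel_additive1 => //.
  have -> : Y = \bigcup_n (ambient_map f @` H n).
    by rewrite -image_bigcup -eX (LCmap_onto gLC).
  exists (fun n => ambient_map f @` H n) => // n.
  by apply: (image_closed gLC) => // x Hx; rewrite eX; exists n.
have [a1|a1] := multiplicative_ge1 hX; last first.
  exact: (image_multiplicative gLC a1 hX).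
apply: Borel_multiplicative1 => //; apply: (image_Gdelta gLC).
have /additiveC/additiveP[[_ /FsigmaC//]|[a2]] := hX.
by case: (ord_is1_gt1 a1 a2).
Qed.
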